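(* The game CRIM restricted to row partitions is pet and returnable but not forced.
   Context: A row is a partition $[c]$ with a single part $c$. CRIM on rows is the impartial game whose positions are the rows $[c]$, $c\ge1$, together with the empty partition $[\,]$ (viewed as $c=0$), and whose moves are those of CRIM. In general, a move of CRIM removes one row or one column from the Young diagram of a partition, with the remaining pieces re-attached to form a partition. On rows, this means that from $[c]$ with $c\ge1$ one can move to $[\,]$ (remove the row) or to $[c-1]$ (remove a column). The only terminal position is $[\,]$. The Sprague-Grundy value $\mathcal{G}(\lambda)$ is the minimal excluded nonnegative integer (mex) of the values $\mathcal{G}(\mu)$ over all $\mu$ reachable from $\lambda$ in one move, so terminal positions have value $0$. The misère Grundy value $\mathcal{G}^-(\lambda)$ satisfies the same mex recursion at non-terminal positions, but terminal positions have $\mathcal{G}^-=1$. A position is called an $(a,b)$-position if its Conway pair $(\mathcal{G}(\lambda),\mathcal{G}^-(\lambda))$ equals $(a,b)$. A game is: - returnable if for any move from a $(0,1)$-position (resp. a $(1,0)$-position) to a non-terminal position $y$, there is a move from $y$ to a $(0,1)$-position (resp. to a $(1,0)$-position); - forced if each move from a $(0,1)$-position results in a $(1,0)$-position and vice versa; - pet if it has only $(0,1)$-positions, $(1,0)$-positions, and $(k,k)$-positions with $k\ge2$. *)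

(* Defs.v *)
From HB Require Import structures.
From mathcomp Require Import all_boot.

Set Implicit Arguments.
Unset Strict Implicit.
Unset Printing Implicit Defensive.

Lemma mex_ex (s : seq nat) : exists n, n \notin s.
Proof.
exists (\max_(i <- s) i).+1; apply/negP => h.
by have := @leq_bigmax_seq _ s xpredT id _ h isT; rewrite ltnn.
Qed.

Definition mex (s : seq nat) : nat := ex_minn (mex_ex s).

(* The list [options x] may contain repetitions; only membership matters. *)
Record impartial_game := ImpartialGame {
  position :> choiceType;
  options : position -> seq position;
  options_wf : well_founded (fun y x => y \in options x)
}.

Section Values.
Variable G : impartial_game.

Definition terminal (x : G) : bool := nilp (options x).

(* [t] is the value given to terminal positions. The elements of
   [seq_sub (options x)] are the options of [x] together with a proof of
   membership, which the well-founded recursion consumes. *)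
Definition value_step (t : nat) (x : G)
    (rec : forall y : G, y \in options x -> nat) : nat :=
  if terminal x then t
  else mex [seq rec (val y) (valP y) | y <- enum {: seq_sub (options x)}].

Definition value (t : nat) : G -> nat :=
  Fix (@options_wf G) (fun _ => nat) (value_step t).

Definition grundy : G -> nat := value 0.
Definition misere_grundy : G -> nat := value 1.

Lemma eq_mex (s1 s2 : seq nat) : s1 =i s2 -> mex s1 = mex s2.
Proof.
move=> e; rewrite /mex; case: ex_minnP => m mP ml; case: ex_minnP => n nP nl.
by apply/eqP; rewrite eqn_leq ml ?e // nl -?e.
Qed.

Lemma valueE t (x : G) :
  value t x = if terminal x then t else mex [seq value t y | y <- options x].
Proof.
rewrite {1}/value Fix_eq => [|y f g fg]; last first.
  by rewrite /value_step; case: ifP => // _; congr mex; apply: eq_map => z.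
rewrite /value_step; case: ifP => // _; apply: eq_mex => n.
apply/mapP/mapP => [[y _ ->]|[y yx ->]]; last first.
  by exists (SeqSub yx); rewrite ?mem_enum.
by exists (val y); [exact: (valP y)|].
Qed.

Lemma grundyE (x : G) : grundy x = mex [seq grundy y | y <- options x].
Proof.
rewrite /grundy valueE /terminal; case: (options x) => [|//] /=.
by rewrite /mex; case: ex_minnP => m _ /(_ 0 isT); rewrite leqn0 => /eqP.
Qed.

Definition is_pos (a b : nat) (x : G) : Prop :=
  (grundy x, misere_grundy x) = (a, b).

Definition returnable : Prop :=
  (forall x y : G, is_pos 0 1 x -> y \in options x -> ~~ terminal y ->
     exists2 z : G, z \in options y & is_pos 0 1 z) /\
  (forall x y : G, is_pos 1 0 x -> y \in options x -> ~~ terminal y ->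
     exists2 z : G, z \in options y & is_pos 1 0 z).

Definition forced : Prop :=
  (forall x y : G, is_pos 0 1 x -> y \in options x -> is_pos 1 0 y) /\
  (forall x y : G, is_pos 1 0 x -> y \in options x -> is_pos 0 1 y).

Definition pet : Prop :=
  forall x : G,
    is_pos 0 1 x \/ is_pos 1 0 x \/ exists2 k, 2 <= k & is_pos k k x.

End Values.

Arguments pet : clear implicits.
Arguments returnable : clear implicits.
Arguments forced : clear implicits.

Section Restriction.
Variables (G : impartial_game) (P : pred G).

(* Moves leaving [P] are discarded; this is the game [G] started from positions
   in [P] when [P] is closed under moves. *)
Definition restrict_options (x : {x : G | P x}) : seq {x : G | P x} :=
  pmap insub (options (val x)).

Lemma mem_restrict_options x y :
  (y \in restrict_options x) = (val y \in options (val x)).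
Proof. by rewrite /restrict_options mem_pmap_sub. Qed.

Lemma restrict_options_wf : well_founded (fun y x => y \in restrict_options x).
Proof.
move=> [x Px]; elim/(well_founded_ind (@options_wf G)): x Px => x IH Px.
by constructor=> -[y Py]; rewrite mem_restrict_options => /IH.
Qed.

Definition restrict : impartial_game := ImpartialGame restrict_options_wf.

End Restriction.

Definition is_part (s : seq nat) : bool := sorted geq s && (0 \notin s).

Record part := Part { parts :> seq nat; partsP : is_part parts }.
HB.instance Definition _ := [isSub for parts].
HB.instance Definition _ := [Equality of part by <:].
HB.instance Definition _ := [Choice of part by <:].

(* Rows and columns are numbered from 0. *)
Definition del_row (i : nat) (s : seq nat) : seq nat := take i s ++ drop i.+1 s.

(* Column [j] meets exactly the rows of length greater than [j]. *)
Definition del_col (j : nat) (s : seq nat) : seq nat :=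
  [seq c <- [seq c - (j < c) | c <- s] | c != 0].

Lemma geq_trans : transitive geq.
Proof. by move=> a b c ba ca; apply: leq_trans ca ba. Qed.

Lemma del_rowP i (s : part) : is_part (del_row i s).
Proof.
case: s => s /andP[/= so s0]; have sub : subseq (del_row i s) s.
  rewrite -{2}(cat_take_drop i s) /del_row cat_subseq //.
  by rewrite -addn1 addnC -drop_drop drop_subseq.
rewrite /is_part (subseq_sorted geq_trans sub so).
by apply: contra s0; apply: mem_subseq.
Qed.

Lemma del_colP j (s : part) : is_part (del_col j s).
Proof.
case: s => s /andP[/= so s0]; rewrite /is_part mem_filter eqxx /= andbT.
apply: (sorted_filter geq_trans); apply: (homo_sorted _ _ so) => a b /= ba.
case: (ltnP j b) => [jb|bj]; first by rewrite (leq_trans jb ba) leq_sub2r.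
case: (ltnP j a) => [ja|_]; last by rewrite !subn0.
by rewrite subn0 subn1 -ltnS prednK ?(leq_trans _ ja) // (leq_ltn_trans bj).
Qed.

Definition crim_options (s : part) : seq part :=
  [seq Part (del_rowP i s) | i <- iota 0 (size s)] ++
  [seq Part (del_colP j s) | j <- iota 0 (head 0 s)].

Lemma sumn_del_row i (s : part) : i < size s -> sumn (del_row i s) < sumn s.
Proof.
case: s => s /= /andP[_ s0] lt_is.
rewrite /del_row -{3}(cat_take_drop i s) (drop_nth 0 lt_is) !sumn_cat /=.
rewrite ltn_add2l -[ltnLHS]add0n ltn_add2r lt0n.
by apply: contra s0 => /eqP <-; apply: mem_nth.
Qed.

Lemma sumn_del_col j (s : part) : j < head 0 s -> sumn (del_col j s) < sumn s.
Proof.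
case: s => s /= _; rewrite /del_col.
have -> (t : seq nat) : sumn [seq c <- t | c != 0] = sumn t.
  by elim: t => //= -[|c] t IH //=; rewrite IH.
have le (t : seq nat) : sumn [seq c - (j < c) | c <- t] <= sumn t.
  by elim: t => //= c t IH; rewrite leq_add ?leq_subr.
case: s => //= c s jc; rewrite jc -addSn leq_add //.
by rewrite subn1 prednK // (leq_ltn_trans _ jc).
Qed.

Lemma crim_options_wf : well_founded (fun y x => y \in crim_options x).
Proof.
have lt_sumn (x y : part) : y \in crim_options x -> sumn y < sumn x.
  rewrite mem_cat => /orP[] /mapP[i]; rewrite mem_iota add0n => /= h ->.
    exact: sumn_del_row.
  exact: sumn_del_col.
move=> x; have [n] := ubnP (sumn x); elim: n x => [|n IH] x lt_xn.
  by rewrite ltn0 in lt_xn.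
apply: Acc_intro => y yx; apply: (IH y).
exact: leq_trans (lt_sumn x y yx) lt_xn.
Qed.

Definition crim : impartial_game := ImpartialGame crim_options_wf.

(* The rows [c] with c >= 1 and the empty partition. *)
Definition is_row (s : crim) : bool := size (parts s) <= 1.

Lemma is_row_closed (x y : crim) : is_row x -> y \in options x -> is_row y.
Proof.
rewrite /is_row /= mem_cat => hx /orP[] /mapP[i _ ->] /=.
  apply: leq_trans hx; rewrite size_cat size_take size_drop.
  case: ltnP => h; last by rewrite (eqP (_ : _ - i.+1 == 0)) ?addn0 // subn_eq0 leqW.
  by rewrite -[leqRHS](subnKC (ltnW h)) leq_add2l leq_sub2l.
by rewrite (leq_trans _ hx) // size_filter (leq_trans (count_size _ _)) ?size_map.
Qed.

Definition crim_rows : impartial_game := restrict is_row.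

(* Main.v *)
Require Import Defs.
From mathcomp Require Import all_boot.

(** The options of [c.+1] are [] and [c], so induction on c gives the Conway
    pairs: (0,1) for [], (1,0) for c odd and (2,2) for c >= 2 even. Only [] is a
    (0,1)-position; from an odd row the only move to a non-terminal position
    leads to an even row, from which removing a column gives an odd row again.
    The move from [3] to [2] shows that the game is not forced. *)

(** Reduces a mex computation to membership checks on a guessed value. *)
Lemma mex_unique (s : seq nat) m :
  m \notin s -> {in gtn m, forall n, n \in s} -> mex s = m.
Proof.
move=> ms lt_s; rewrite /mex; case: ex_minnP => n ns /(_ m ms) n_le.
by apply/eqP; rewrite eqn_leq n_le leqNgt; apply: contra ns => /lt_s.
Qed.

(** The multiplicity [c != 0] yields the empty list at 0, as a partition has no zero part. *)
Definition row_seq (c : nat) : seq nat := nseq (c != 0) c.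

Lemma row_seq_part c : is_part (row_seq c).
Proof. by case: c. Qed.

Lemma row_seq_row c : is_row (Part (row_seq_part c)).
Proof. by case: c. Qed.

Definition row (c : nat) : crim_rows :=
  Sub (Part (row_seq_part c)) (row_seq_row c).

Lemma eq_row (x : crim_rows) c : val (val x) = row_seq c -> x = row c.
Proof. by move=> e; do 2!apply: val_inj. Qed.

Lemma row_surj (x : crim_rows) : exists c, x = row c.
Proof.
case: x => -[[|c [|//]] p] r; first by exists 0; apply: eq_row.
(* A single part 0 is excluded by [p]. *)
by exists c; apply: eq_row; case: c p r.
Qed.

Lemma options_row0 : options (row 0) = [::].
Proof. by []. Qed.

(** Every column of a row is one cell, so which one is removed does not matter. *)
Lemma del_col_row j c : j <= c -> del_col j (row_seq c.+1) = row_seq c.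
Proof. by rewrite /del_col /= ltnS => ->; rewrite subn1; case: c. Qed.

(** Only [=i] holds in general: [row c] is listed once for each of the [c.+1] columns. *)
Lemma options_rowS c : options (row c.+1) =i [:: row 0; row c].
Proof.
move=> y; rewrite mem_restrict_options mem_cat [RHS]in_cons [in RHS]mem_seq1.
congr (_ || _).
  by rewrite mem_seq1 -!val_eqE.
apply/mapP/eqP => [[j]|->].
  rewrite mem_iota => /= jc e; apply: eq_row; rewrite -(@del_col_row j) //.
  exact: (congr1 parts e).
by exists 0 => //; apply: val_inj; rewrite /= del_col_row.
Qed.

Lemma terminal_row c : terminal (row c) = (c == 0).
Proof.
case: c => [|c] //; rewrite /terminal; have := options_rowS c (row 0).
by rewrite mem_head; case: (options _).
Qed.

Lemma value_row0 t : value t (row 0) = t.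
Proof. by rewrite valueE terminal_row. Qed.

Lemma value_rowS t c : value t (row c.+1) = mex [:: t; value t (row c)].
Proof.
rewrite valueE terminal_row; apply: eq_mex => n.
by rewrite (eq_mem_map _ (options_rowS c)) /= value_row0.
Qed.

(** Handles normal play ([t = 0]) and misère play ([t = 1]) at once: the sets {t} and {t, 2} have
    mex [1 - t], while {t, 1 - t} has mex 2. *)
Lemma value_row t c : t <= 1 ->
  value t (row c) = if c == 0 then t else if odd c then 1 - t else 2.
Proof.
move=> t1; elim: c => [|c IH]; first exact: value_row0.
rewrite value_rowS IH; apply: mex_unique.
  by case: c {IH} t t1 => [|c] [|[|//]] _ //=; case: (odd c).
by case: c {IH} t t1 => [|c] [|[|//]] _ [|[|n]] //=; case: (odd c).
Qed.

Lemma conway_pair_row c : (grundy (row c), misere_grundy (row c)) =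
  if c == 0 then (0, 1) else if odd c then (1, 0) else (2, 2).
Proof.
by rewrite /grundy /misere_grundy !value_row //; case: eqP => _; [|case: odd].
Qed.

Lemma is_pos01_row c : is_pos 0 1 (row c) <-> c = 0.
Proof. by rewrite /is_pos conway_pair_row; case: c => //= c; case: odd. Qed.

Lemma is_pos10_row c : is_pos 1 0 (row c) <-> odd c.
Proof. by rewrite /is_pos conway_pair_row; case: c => //= c; case: odd. Qed.

Lemma pet_crim_rows : pet crim_rows.
Proof.
move=> x; have [c ->] := row_surj x.
have [/is_pos10_row|c_even] := boolP (odd c).
  by right; left.
case: c c_even => [|c] c_even; first by left; apply/is_pos01_row.
by right; right; exists 2; rewrite // /is_pos conway_pair_row (negPf c_even).
Qed.

Lemma returnable_crim_rows : returnable crim_rows.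
Proof.
split=> x y; have [c ->] := row_surj x.
  (* Vacuous: the only (0,1)-position has no moves. *)
  by move/is_pos01_row->; rewrite options_row0.
move/is_pos10_row; case: c => // c c_even; rewrite options_rowS !inE.
case/orP=> /eqP->; rewrite terminal_row //; case: c c_even => // c c_odd _.
exists (row c); first by rewrite options_rowS !inE eqxx orbT.
by apply/is_pos10_row; rewrite /= negbK in c_odd.
Qed.

Lemma not_forced_crim_rows : ~ forced crim_rows.
Proof.
(* [row 1] would not serve: its only option [row 0] is a (0,1)-position. *)
case=> _ /(_ (row 3) (row 2)) H; suff /is_pos01_row: is_pos 0 1 (row 2) by [].
by apply: H; [apply/is_pos10_row | rewrite options_rowS !inE eqxx orbT].
Qed.

Theorem theorem18 :
  pet crim_rows /\ returnable crim_rows /\ ~ forced crim_rows.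
Proof.
split; first exact: pet_crim_rows.
by split; [exact: returnable_crim_rows | exact: not_forced_crim_rows].
Qed.
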